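(* Let $x=(x_1,x_2,\ldots,x_n)\in S_{\ell_\infty^n}$. Then $x$ is $\rho$-right symmetric if and only if at least one of the following holds: (i) $x\in Ext(B_{\ell_\infty^n})$; (ii) for each $j\in\{1,2,\ldots,n\}\setminus\mathcal{I}_x$ one has $0<|x_j|<1$, and moreover $|x_j|\ne|x_k|$ for all distinct $j,k\in\{1,2,\ldots,n\}\setminus\mathcal{I}_x$.
   Context: $\ell_\infty^n$ is $\mathbb{R}^n$ with the norm $\|x\|=\max_i|x_i|$; $B_\mathbb{X}$ and $S_\mathbb{X}$ are the closed unit ball and unit sphere of a normed space $\mathbb{X}$, and $Ext(C)$ is the set of extreme points of a convex set $C$. For $x\in\mathbb{R}^n$, $\mathcal{I}_x=\{i\in\{1,\ldots,n\}:|x_i|=1\}$. Norm derivatives: $\rho'_{\pm}(x,y)=\|x\|\lim_{t\to 0^{\pm}}\frac{\|x+ty\|-\|x\|}{t}$ and $\rho'(x,y)=\frac12(\rho'_+(x,y)+\rho'_-(x,y))$. $\rho$-orthogonality: $x\perp_\rho y$ means $\rho'(x,y)=0$. An element $x\in\mathbb{X}$ is $\rho$-right symmetric if $y\perp_\rho x$ implies $x\perp_\rho y$ for all $y\in\mathbb{X}$. *)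

(* Defs.v *)
From HB Require Import structures.
From mathcomp Require Export all_boot all_order all_algebra.
From mathcomp Require Export boolp classical_sets reals topology normedtype.

Set Implicit Arguments.
Unset Strict Implicit.
Unset Printing Implicit Defensive.

Import Order.TTheory GRing.Theory Num.Theory.
Import numFieldNormedType.Exports.

Local Open Scope classical_set_scope.
Local Open Scope ring_scope.

Section NormedSpace.
Context {R : realType} {V : normedModType R}.
Implicit Types (x y : V) (C : set V).

Definition unit_ball : set V := [set x | `|x| <= 1].

Definition unit_sphere : set V := [set x | `|x| = 1].

Definition extreme_points C : set V :=
  [set x | C x /\ forall (y z : V) (t : R), C y -> C z -> 0 < t < 1 ->
             x = (1 - t) *: y + t *: z -> y = x /\ z = x].

(* [lim] is total, but both one-sided limits exist for all x and y, because
   t |-> `|x + t *: y| is convex. *)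
Definition rho_plus x y : R :=
  `|x| * lim ((`|x + t *: y| - `|x|) / t @[t --> (0 : R)^'+]).

Definition rho_minus x y : R :=
  `|x| * lim ((`|x + t *: y| - `|x|) / t @[t --> (0 : R)^'-]).

Definition rho x y : R := (rho_plus x y + rho_minus x y) / 2.

Definition rho_orthogonal x y : Prop := rho x y = 0.

Definition rho_right_symmetric x : Prop :=
  forall y, rho_orthogonal y x -> rho_orthogonal x y.

End NormedSpace.

Arguments unit_ball {R} V.
Arguments unit_sphere {R} V.

(* The library's norm on matrices is the maximum of the absolute values of the
   entries, so the normed space of row vectors is l_infty^n. *)
Definition linfty (R : realType) (n : nat) : normedModType R := 'rV[R]_n.

Lemma linfty_normE (R : realType) (n : nat) (x : 'rV[R]_n) :
  `|x : linfty R n| = \big[Num.max/0]_(i < n) `|x ord0 i|.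
Proof.
rewrite [LHS]mx_normrE; apply/le_anti/andP; split.
  apply/bigmax_leP; split; first exact: bigmax_ge_id.
  by move=> [i j] _ /=; rewrite ord1; apply: (le_bigmax _ (fun i => `|x ord0 i|)).
apply/bigmax_leP; split; first exact: bigmax_ge_id.
by move=> i _; apply: (le_bigmax _ (fun ij => `|x ij.1 ij.2|) (ord0, i)).
Qed.

Definition unit_coords (R : realType) (n : nat) (x : 'rV[R]_n) : {set 'I_n} :=
  [set i | `|x ord0 i| == 1]%SET.

(* Main.v *)
(* In l_infty^n the one-sided derivative rho_+(x, y) (resp. rho_-(x, y)) is the
   maximum (resp. minimum) of x_k y_k over the coordinates k where |x_k| is
   maximal.  If y _|_rho x with y <> 0, then y_i x_i = - y_j x_j for a maximizing
   i and a minimizing j, with |y_i| = |y_j| = |y|, so |x_i| = |x_j|; condition (ii)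
   forces |x_i| = |x_j| = 1, and the same i and j then show x _|_rho y.  If (ii)
   fails at j (x_j = 0) or at j, k (|x_j| = |x_k| < 1), modify x in these
   coordinates only, so that they become the maximal ones of y and y _|_rho x;
   since y agrees with x where |x_i| = 1, rho(x, y) = 1.  Condition (i) is the
   vacuous case of (ii). *)
Require Import Defs.
From mathcomp Require Import all_boot all_order all_algebra.
From mathcomp Require Import boolp classical_sets reals topology normedtype.
From mathcomp Require Import ring lra.
Import Order.TTheory GRing.Theory Num.Theory.
Import numFieldNormedType.Exports.
Local Open Scope classical_set_scope.
Local Open Scope ring_scope.

(** * Coordinates at which the maximum norm is attained *)

Lemma coord_le_norm {R : realType} {n : nat} (x : 'rV[R]_n) (i : 'I_n) :
  `|x ord0 i| <= `|x : linfty R n|.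
Proof. by rewrite linfty_normE; exact: (le_bigmax _ (fun i => `|x ord0 i|)). Qed.

Lemma linfty_norm_le {R : realType} {n : nat} (x : 'rV[R]_n) (c : R) :
  0 <= c -> (forall i, `|x ord0 i| <= c) -> `|x : linfty R n| <= c.
Proof. by move=> c0 xc; rewrite linfty_normE; apply/bigmax_leP; split. Qed.

Definition norming {R : realType} {n : nat} (x : 'rV[R]_n) : pred 'I_n :=
  fun i => `|x ord0 i| == `|x : linfty R n|.

Lemma norming_exists {R : realType} {n : nat} (x : 'rV[R]_n.+1) :
  exists i, norming x i.
Proof.
have [i _ max_i] := @arg_maxP _ R 'I_n.+1 ord0 predT (fun i => `|x ord0 i|) isT.
exists i; rewrite /norming eq_le coord_le_norm linfty_norm_le//.
by move=> k; exact: max_i.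
Qed.

Lemma norming_max {R : realType} {n : nat} (x y : 'rV[R]_n.+1) :
  exists2 i, norming x i &
    forall k, norming x k -> x ord0 k * y ord0 k <= x ord0 i * y ord0 i.
Proof.
have [i0 i0P] := norming_exists x.
have [i iP max_i] :=
  @arg_maxP _ R _ i0 (norming x) (fun k => x ord0 k * y ord0 k) i0P.
by exists i.
Qed.

Lemma norming_min {R : realType} {n : nat} (x y : 'rV[R]_n.+1) :
  exists2 i, norming x i &
    forall k, norming x k -> x ord0 i * y ord0 i <= x ord0 k * y ord0 k.
Proof.
have [i iP max_i] := norming_max x (- y); exists i => // k /max_i.
by rewrite !mxE !mulrN lerN2.
Qed.

(** * One-sided norm derivatives of the maximum norm *)

Lemma near0_right_mul_lt {R : realType} (c e : R) :
  0 < e -> \forall t \near (0 : R)^'+, t * c < e.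
Proof.
move=> e0; near=> t; have t0 : 0 < t by [].
have : t < e / (`|c| + 1).
  near: t; apply: nbhs_right_lt.
  by rewrite divr_gt0// ltr_wpDl.
rewrite ltr_pdivlMr ?ltr_wpDl//; apply: le_lt_trans.
by rewrite ler_pM2l// (le_trans (ler_norm _))// lerDl.
Unshelve. all: by end_near. Qed.

(** For small [t > 0] a norming coordinate contributes exactly [N + t * (x_k y_k / N)], with slope
    at most [a], while every other coordinate starts strictly below [N] and cannot catch up. Hence
    the norm is exactly affine in [t] near [0] from the right. *)
Lemma norm_linfty_near {R : realType} {n : nat} (x y : 'rV[R]_n) (i : 'I_n) (a : R) :
  0 < `|x : linfty R n| -> norming x i ->
  (forall k, norming x k -> x ord0 k * y ord0 k <= x ord0 i * y ord0 i) ->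
  x ord0 i * y ord0 i = `|x : linfty R n| * a ->
  \forall t \near (0 : R)^'+,
    `|(x : linfty R n) + t *: (y : linfty R n)| = `|x : linfty R n| + t * a.
Proof.
set N : R := `|x : linfty R n| => N0 iP max_i ia.
have bound : \forall t \near (0 : R)^'+,
    forall k, `|x ord0 k + t * y ord0 k| <= N + t * a.
  apply: filter_forall => k.
  have [kP|kNP] := boolP (norming x k).
    have yka : x ord0 k * y ord0 k <= N * a by rewrite -ia max_i.
    (* Knowing the sign of [x_k] turns maximality of the product into a bound on [y_k] or [- y_k];
       smallness of [t] is needed only to keep [x_k + t y_k] from changing sign. *)
    have [xk|xk] : x ord0 k = N \/ x ord0 k = - N.
    - have kN : `|x ord0 k| = N := eqP kP.
      by rewrite -kN; case: ler0P => _; [right; rewrite opprK|left].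
    - have {}yka : y ord0 k <= a by move: yka; rewrite xk ler_pM2l.
      near=> t; have t0 : 0 < t by [].
      have tyk : t * - y ord0 k < N by near: t; exact: near0_right_mul_lt.
      have tya : t * y ord0 k <= t * a by rewrite ler_pM2l.
      by rewrite xk ler_norml; apply/andP; split; lra.
    - have {}yka : - y ord0 k <= a by move: yka; rewrite xk mulNr -mulrN ler_pM2l.
      near=> t; have t0 : 0 < t by [].
      have tyk : t * y ord0 k < N by near: t; exact: near0_right_mul_lt.
      have tya : t * - y ord0 k <= t * a by rewrite ler_pM2l.
      by rewrite xk ler_norml; apply/andP; split; lra.
  have xkN : `|x ord0 k| < N by rewrite lt_neqAle kNP coord_le_norm.
  near=> t; have t0 : 0 < t by [].
  have tN : t * (`|y ord0 k| - a) < N - `|x ord0 k|.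
    by near: t; apply: near0_right_mul_lt; rewrite subr_gt0.
  have := ler_normD (x ord0 k) (t * y ord0 k).
  by rewrite normrM (gtr0_norm t0); lra.
near=> t; have t0 : 0 < t by [].
have le_t : forall k, `|x ord0 k + t * y ord0 k| <= N + t * a by near: t.
apply/le_anti/andP; split.
  apply: (@linfty_norm_le _ _ (x + t *: y)) => [|k]; last by rewrite !mxE.
  exact: le_trans (normr_ge0 _) (le_t i).
apply: le_trans (coord_le_norm (x + t *: y) i); rewrite !mxE.
move/eqP: iP; rewrite -/N => iN.
have xx : x ord0 i * x ord0 i = N * N by rewrite -!expr2 -iN real_normK ?num_real.
(* Multiplying by [N = |x_i|] avoids a case split on the sign of [x_i]:
   [x_i (x_i + t y_i) = N (N + t a)]. *)
rewrite -(ler_pM2l N0) -{3}iN -normrM; apply: le_trans (ler_norm _).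
by rewrite !mulrDr xx mulrCA -ia [in leRHS]mulrCA.
Unshelve. all: by end_near. Qed.

Lemma rho_quotient_near {R : realType} {n : nat} (x y : 'rV[R]_n) (i : 'I_n) :
  0 < `|x : linfty R n| -> norming x i ->
  (forall k, norming x k -> x ord0 k * y ord0 k <= x ord0 i * y ord0 i) ->
  \forall t \near (0 : R)^'+,
    (`|(x : linfty R n) + t *: (y : linfty R n)| - `|x : linfty R n|) / t =
    x ord0 i * y ord0 i / `|x : linfty R n|.
Proof.
move=> N0 iP max_i; set a : R := x ord0 i * y ord0 i / `|x : linfty R n|.
have ia : x ord0 i * y ord0 i = `|x : linfty R n| * a.
  by rewrite mulrCA divff ?mulr1// gt_eqF.
have nearE := norm_linfty_near _ _ _ _ N0 iP max_i ia.
near=> t; have t0 : 0 < t by [].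
have -> : `|(x : linfty R n) + t *: (y : linfty R n)| = `|x : linfty R n| + t * a.
  by near: t.
by rewrite addrAC subrr add0r mulrC mulKf// gt_eqF.
Unshelve. all: by end_near. Qed.

Lemma rho_plus_linfty {R : realType} {n : nat} (x y : 'rV[R]_n) (i : 'I_n) :
  norming x i ->
  (forall k, norming x k -> x ord0 k * y ord0 k <= x ord0 i * y ord0 i) ->
  rho_plus (x : linfty R n) y = x ord0 i * y ord0 i.
Proof.
move=> iP max_i; rewrite /rho_plus.
(* At [x = 0] both sides vanish; otherwise the difference quotient is eventually constant, which
   gives the limit. *)
have [x0|xN0] := eqVneq `|x : linfty R n| 0.
  by move: iP; rewrite /norming x0 normr_eq0 => /eqP ->; rewrite !mul0r.
have N0 : 0 < `|x : linfty R n| by rewrite lt_def xN0 normr_ge0.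
rewrite (lim_near_cst _ (rho_quotient_near _ _ _ N0 iP max_i))//.
by rewrite mulrCA divff ?mulr1.
Qed.

Lemma rho_minus_linfty {R : realType} {n : nat} (x y : 'rV[R]_n) (i : 'I_n) :
  norming x i ->
  (forall k, norming x k -> x ord0 i * y ord0 i <= x ord0 k * y ord0 k) ->
  rho_minus (x : linfty R n) y = x ord0 i * y ord0 i.
Proof.
move=> iP min_i; rewrite /rho_minus.
have [x0|xN0] := eqVneq `|x : linfty R n| 0.
  by move: iP; rewrite /norming x0 normr_eq0 => /eqP ->; rewrite !mul0r.
have N0 : 0 < `|x : linfty R n| by rewrite lt_def xN0 normr_ge0.
have max_i k : norming x k -> x ord0 k * (- y) ord0 k <= x ord0 i * (- y) ord0 i.
  by move=> /min_i; rewrite !mxE !mulrN lerN2.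
have nearE := rho_quotient_near _ _ _ N0 iP max_i.
rewrite (@lim_near_cst _ _ _ _ _ (x ord0 i * y ord0 i / `|x : linfty R n|))//.
  by rewrite mulrCA divff ?mulr1.
(* The substitution of [-t] for [t] turns the left limit along [y] into minus the right limit along
   [-y]. *)
rewrite -[X in X^'-]oppr0 at_leftN; move: nearE; rewrite !near_simpl /=.
apply: filterS => t /= tE.
rewrite scaleNr -scalerN invrN mulrN tE.
by rewrite mxE mulrN mulNr opprK.
Qed.

Lemma rho_linfty {R : realType} {n : nat} (x y : 'rV[R]_n) (i j : 'I_n) :
  norming x i ->
  (forall k, norming x k -> x ord0 k * y ord0 k <= x ord0 i * y ord0 i) ->
  norming x j ->
  (forall k, norming x k -> x ord0 j * y ord0 j <= x ord0 k * y ord0 k) ->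
  rho (x : linfty R n) y = (x ord0 i * y ord0 i + x ord0 j * y ord0 j) / 2.
Proof.
move=> iP max_i jP min_j.
by rewrite /rho (rho_plus_linfty _ _ _ iP)//
  (rho_minus_linfty _ _ _ jP).
Qed.

(** * Right symmetry of unit vectors and condition (ii) *)

Lemma norming_unit_coords {R : realType} {n : nat} (x : 'rV[R]_n) (i : 'I_n) :
  `|x : linfty R n| = 1 -> norming x i = (i \in unit_coords x).
Proof. by move=> x1; rewrite /norming x1 inE. Qed.

Lemma rho_eq1 {R : realType} {n : nat} (x y : 'rV[R]_n.+1) :
  `|x : linfty R n.+1| = 1 ->
  (forall i, norming x i -> y ord0 i = x ord0 i) ->
  rho (x : linfty R n.+1) y = 1.
Proof.
move=> x1 yx.
have xy1 i : norming x i -> x ord0 i * y ord0 i = 1.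
  by move=> iP; rewrite yx// -expr2 -real_normK ?num_real// (eqP iP) x1 expr1n.
have [i iP max_i] := norming_max x y; have [j jP min_j] := norming_min x y.
by rewrite (rho_linfty _ _ _ _ iP max_i jP min_j) !xy1//; lra.
Qed.

(* With j = k and s = -1, the hypothesis x_j = s x_k says x_j = 0. *)
Lemma not_rho_right_symmetric {R : realType} {n : nat} (x : 'rV[R]_n.+1)
    (j k : 'I_n.+1) (s : R) :
  `|x : linfty R n.+1| = 1 -> j \notin unit_coords x -> k \notin unit_coords x ->
  s = 1 \/ s = -1 -> x ord0 j = s * x ord0 k -> (j = k -> s = -1) ->
  ~ rho_right_symmetric (x : linfty R n.+1).
Proof.
move=> x1 jP kP s1 xjk jks.
(* The value 2 exceeds every [|x_l|], so exactly [j] and [k] are norming for [y]; the factor [-s]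
   makes the products [y_j x_j] and [y_k x_k] opposite. If [j = k], then [s = -1] and both
   prescriptions give 2. *)
pose y : 'rV[R]_n.+1 :=
  \row_l if l == j then 2 else if l == k then - 2 * s else x ord0 l.
have yj : y ord0 j = 2 by rewrite mxE eqxx.
have yk : y ord0 k = - 2 * s.
  by rewrite mxE eqxx; case: eqP => // /esym /jks ->; lra.
have y2 : 2 <= `|y : linfty R n.+1|.
  by have := coord_le_norm y j; rewrite yj ger0_norm.
have normingy l : norming y l -> l = j \/ l = k.
  have [->|lj] := eqVneq l j; first by left.
  have [->|lk] := eqVneq l k; first by right.
  rewrite /norming mxE (negbTE lj) (negbTE lk) => /eqP xl.
  by exfalso; have := coord_le_norm x l; rewrite xl x1; lra.
have y_le2 : `|y : linfty R n.+1| <= 2.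
  apply: linfty_norm_le => // l; rewrite mxE.
  case: ifP => _; first by rewrite ger0_norm.
  case: ifP => _; first by rewrite ler_norml; case: s1 => ->; apply/andP; split; lra.
  by have := coord_le_norm x l; rewrite x1; lra.
have normy : `|y : linfty R n.+1| = 2 by apply/le_anti/andP.
have jPy : norming y j by rewrite /norming normy yj ger0_norm.
have kPy : norming y k.
  rewrite /norming normy yk; case: s1 => ->; rewrite ?mulrN1 ?mulr1 ?opprK.
    by rewrite normrN ger0_norm.
  by rewrite ger0_norm.
have ykxk : y ord0 k * x ord0 k = - (y ord0 j * x ord0 j).
  by rewrite yj yk xjk; lra.
have ortho : rho_orthogonal (y : linfty R n.+1) x.
  have [i iP max_i] := norming_max y x; have [l lP min_l] := norming_min y x.
  rewrite /rho_orthogonal (rho_linfty _ _ _ _ iP max_i lP min_l).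
  (* Only the two opposite values [y_j x_j] and [y_k x_k] occur, so the maximum and the minimum
     cancel. *)
  move: (max_i _ jPy) (max_i _ kPy) (min_l _ jPy) (min_l _ kPy); rewrite ykxk.
  by case: (normingy _ iP) => ->; case: (normingy _ lP) => ->; rewrite ?ykxk; lra.
move=> /(_ _ ortho); rewrite /rho_orthogonal rho_eq1 //.
  by move=> /eqP; rewrite oner_eq0.
move=> l; rewrite norming_unit_coords// mxE => lP.
have [lj|_] := eqVneq l j; first by rewrite lj (negbTE jP) in lP.
by have [lk|//] := eqVneq l k; rewrite lk (negbTE kP) in lP.
Qed.

Lemma rho_right_symmetric_of_distinct {R : realType} {n : nat} (x : 'rV[R]_n.+1) :
  `|x : linfty R n.+1| = 1 ->
  (forall j, j \notin unit_coords x -> 0 < `|x ord0 j|) ->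
  (forall j k, j \notin unit_coords x -> k \notin unit_coords x ->
    j <> k -> `|x ord0 j| <> `|x ord0 k|) ->
  rho_right_symmetric (x : linfty R n.+1).
Proof.
move=> x1 pos distinct y; rewrite /rho_orthogonal.
have [-> _|yN0] := eqVneq y 0.
  have [i iP _] := norming_max x x.
  by rewrite (rho_linfty x 0 i i)// => [|k _|k _]; rewrite !mxE !mulr0// addr0 mul0r.
have [i iP max_i] := norming_max (y : 'rV[R]_n.+1) x.
have [j jP min_j] := norming_min (y : 'rV[R]_n.+1) x.
rewrite (rho_linfty _ _ _ _ iP max_i jP min_j) => yx.
have N0 : `|y : linfty R n.+1| != 0 by rewrite normr_eq0.
move: iP jP N0 max_i min_j yx; rewrite /norming; clear yN0.
move: y => /= y; set N : R := `|y : linfty R n.+1|.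
move=> /eqP yi /eqP yj N0 max_i min_j yx.
have le_xy k : `|x ord0 k * y ord0 k| <= N.
  rewrite normrM -[N]mul1r ler_pM// ?coord_le_norm//.
  by rewrite -x1 coord_le_norm.
have xji : y ord0 j * x ord0 j = - (y ord0 i * x ord0 i) by lra.
(* Since [|x_k y_k| <= N] for all [k], it then follows that [x_i y_i = N] and [x_j y_j = -N] are the
   extreme products for [x] too, and they cancel. *)
suff [iP jP] : norming x i /\ norming x j.
  have normE l : norming x l -> `|y ord0 l| = N -> `|x ord0 l * y ord0 l| = N.
    by rewrite /norming normrM => /eqP ->; rewrite x1 mul1r.
  have xyi : x ord0 i * y ord0 i = N.
    rewrite -(normE i)// ger0_norm// mulrC.
    by have := max_i j; rewrite yj eqxx => /(_ isT); lra.
  have xyj : x ord0 j * y ord0 j = - N by rewrite mulrC xji mulrC xyi.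
  rewrite (rho_linfty _ _ i j)// => [|k _|k _]; first by lra.
  - by rewrite xyi (le_trans (ler_norm _)).
  - by rewrite xyj; have := le_xy k; rewrite ler_norml => /andP[].
rewrite !norming_unit_coords//.
have xij : `|x ord0 i| = `|x ord0 j|.
  apply: (mulfI N0); rewrite -{1}yi -[in RHS]yj -!normrM.
  by rewrite xji normrN.
(* As [|x_i| = |x_j|], both indices are unit coordinates or neither is. In the latter case
   distinctness gives [i = j], so [y_i x_i] equals its own opposite and [x_i = 0], against
   positivity. *)
have [iP|iNP] := boolP (i \in unit_coords x).
  by move: iP; rewrite !inE -xij => /eqP ->; rewrite eqxx.
have jNP : j \notin unit_coords x by move: iNP; rewrite !inE xij.
have /eqP ij : i == j.
  by apply/negPn/negP => /eqP ij; case: (distinct _ _ iNP jNP ij).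
have /eqP : y ord0 i * x ord0 i = 0 by rewrite -ij in xji; lra.
rewrite mulf_eq0 -normr_eq0 yi (negbTE N0)/= => /eqP xi0.
by have := pos _ iNP; rewrite xi0 normr0 ltxx.
Qed.

(** * Extreme points and the characterization *)

Lemma unit_coords_of_extreme {R : realType} {n : nat} (x : 'rV[R]_n) (j : 'I_n) :
  extreme_points (unit_ball (linfty R n)) x -> j \in unit_coords x.
Proof.
move=> [xB ext]; apply/negPn/negP; rewrite inE => xj1.
have le1 k : `|x ord0 k| <= 1 by exact: le_trans (coord_le_norm x k) xB.
pose d := 1 - `|x ord0 j|.
have d0 : 0 < d by rewrite subr_gt0 lt_neqAle xj1 le1.
(* The slack [d] lets coordinate [j] move by [d] either way inside the ball, making [x] the midpoint
   of [y 1] and [y (-1)]. *)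
pose y (s : R) : 'rV[R]_n := \row_k if k == j then x ord0 j + s * d else x ord0 k.
have yB s : `|s| <= 1 -> unit_ball (linfty R n) (y s).
  move=> s1; apply: linfty_norm_le => // k; rewrite mxE; case: ifP => // _.
  apply: le_trans (ler_normD _ _) _; rewrite normrM (gtr0_norm d0).
  have : `|s| * d <= d by rewrite ler_piMl// ltW.
  by rewrite /d; lra.
have half : 0 < (2^-1 : R) < 1 by apply/andP; split; lra.
have [|||yx _] := ext (y 1) (y (-1)) 2^-1 _ _ half.
- by apply: yB; rewrite normr1.
- by apply: yB; rewrite normrN1.
- apply/rowP => k; rewrite !mxE; case: eqVneq => [->|_]; first by field.
  by field.
have := congr1 (fun z : 'rV[R]_n => z ord0 j) yx; rewrite mxE eqxx; lra.
Qed.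

Theorem theorem3p17 (R : realType) (n : nat) (x : 'rV[R]_n)
    (hx : unit_sphere (linfty R n) x) :
  rho_right_symmetric (x : linfty R n) <->
  (extreme_points (unit_ball (linfty R n)) x \/
   ((forall j : 'I_n, j \notin unit_coords x -> 0 < `|x ord0 j| < 1) /\
    (forall j k : 'I_n, j \notin unit_coords x -> k \notin unit_coords x ->
       j <> k -> `|x ord0 j| <> `|x ord0 k|))).
Proof.
have x1 : `|x : linfty R n| = 1 := hx.
case: n x hx x1 => [|n] x hx x1.
  (* In dimension 0 the norm is an empty maximum, equal to 0, so there is no unit vector. *)
  by move: x1; rewrite linfty_normE big_ord0 => /esym/eqP; rewrite oner_eq0.
have lt1 j : j \notin unit_coords x -> `|x ord0 j| < 1.
  by rewrite inE lt_neqAle => ->; rewrite -x1 coord_le_norm.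
split=> [sym_x|[ext|[pos distinct]]].
- right; split=> [j jP|j k jP kP jk xjk].
    rewrite lt1// andbT normr_gt0; apply/eqP => xj0.
    apply: (not_rho_right_symmetric x j j (-1)) => //; first by right.
    by rewrite xj0 mulr0.
  have [xE|xE] : x ord0 j = x ord0 k \/ x ord0 j = - x ord0 k.
    by move/eqP: xjk; rewrite eqr_norm2 => /orP[]/eqP; [left|right].
  - by apply: (not_rho_right_symmetric x j k 1) => //; [left|rewrite mul1r].
  - by apply: (not_rho_right_symmetric x j k (-1)) => //; [right|rewrite mulN1r].
(* An extreme point has only unit coordinates, so positivity and distinctness hold vacuously. *)
- by apply: rho_right_symmetric_of_distinct => // j; rewrite unit_coords_of_extreme.
- by apply: rho_right_symmetric_of_distinct => // j /pos /andP[].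
Qed.
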